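(* Let $\mathcal H_K$ be a reproducing kernel Hilbert space of complex-valued functions on a set $D$ with bounded kernel $K$, and let $R:=\sup_{x\in D}\sqrt{K(x,x)}<\infty$. (i) If for some $\alpha,C_0>0$ one has $c_n(B_{\mathcal H_K})_\infty\le C_0(1+n)^{-\alpha}$ for all $n\in\mathbb N$, then for all $n\in\mathbb N$ $$g_n^{\mathrm{lin}}(B_{\mathcal H_K})_\infty\le 2^{5\alpha+3}\max\{C_0,R\}\,(1+n)^{-\alpha}.$$ (ii) Let either $\alpha>0$ and $\beta\in\mathbb R$, or $\alpha=0$ and $\beta>0$. There is a constant $C(\alpha,\beta)$ depending only on $\alpha$ and $\beta$ such that, if for some $C_0>0$ one has $c_n(B_{\mathcal H_K})_\infty\le C_0\,n^{-\alpha}(\log n)^{-\beta}$ for all $n\ge2$, then $$g_n^{\mathrm{lin}}(B_{\mathcal H_K})_\infty\le C(\alpha,\beta)\max\{C_0,R\}\,n^{-\alpha}(\log n)^{-\beta}\qquad\text{for all } n\ge2.$$ (In particular $C(\alpha,\beta)$ does not depend on $D$, $K$ or $C_0$.)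
   Context: $B(D)$ is the space of bounded functions $D\to\mathbb C$ with norm $\|f\|_\infty=\sup_{x\in D}|f(x)|$. $\mathcal H_K$ is the reproducing kernel Hilbert space (RKHS) on $D$ with kernel $K\colon D\times D\to\mathbb C$, i.e. $f(x)=\langle f,K(\cdot,x)\rangle_{\mathcal H_K}$ for all $f\in\mathcal H_K$, $x\in D$. The kernel is bounded if $R<\infty$; then $\mathcal H_K$ embeds continuously into $B(D)$. $B_{\mathcal H_K}$ is the unit ball of $\mathcal H_K$. Gelfand widths: for $n\ge1$, $$c_n(B_{\mathcal H_K})_\infty:=\inf_{\psi,N}\ \sup_{f\in B_{\mathcal H_K}}\|f-\psi(Nf)\|_\infty,$$ the infimum over all bounded linear maps $N\colon\mathcal H_K\to\mathbb C^n$ and all (arbitrary, possibly non-linear) maps $\psi\colon\mathbb C^n\to B(D)$. Linear sampling widths: for $m\ge1$, $$g_m^{\mathrm{lin}}(B_{\mathcal H_K})_\infty:=\inf_{x_1,\dots,x_m\in D,\ \varphi}\ \sup_{f\in B_{\mathcal H_K}}\|f-\varphi(f(x_1),\dots,f(x_m))\|_\infty,$$ the infimum over all points and all linear maps $\varphi\colon\mathbb C^m\to B(D)$. *)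

(* Defs.v *)
From HB Require Import structures.
From mathcomp Require Import all_boot all_order all_algebra sesquilinear.
From mathcomp Require Import all_classical all_reals all_analysis.
From mathcomp Require Import complex.

Set Implicit Arguments.
Unset Strict Implicit.
Unset Printing Implicit Defensive.

Import Order.TTheory GRing.Theory Num.Theory.
Import numFieldNormedType.Exports.

Local Open Scope classical_set_scope.
Local Open Scope ring_scope.
Local Open Scope complex_scope.

(* The elements of the Hilbert space are identified with functions on [D]
   through the injective linear map [rkhs_eval]; [rkhs_ksec x] is the element
   corresponding to the function K(., x). The form [rkhs_ip] is linear in its
   first argument and conjugate-linear in the second. *)
Record rkhs (R : realType) (D : Type) (K : D -> D -> R[i]) := RKHS {
  rkhs_space :> completeNormedModType R[i];
  rkhs_ip : {dot rkhs_space for Num.conj};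
  rkhs_normE : forall f : rkhs_space, `|f| ^+ 2 = rkhs_ip f f;
  rkhs_eval : {linear rkhs_space -> (D -> R[i])};
  rkhs_eval_inj : injective rkhs_eval;
  rkhs_ksec : D -> rkhs_space;
  rkhs_ksecE : forall x y : D, rkhs_eval (rkhs_ksec x) y = K y x;
  rkhs_reproducing : forall (f : rkhs_space) (x : D),
    rkhs_eval f x = rkhs_ip f (rkhs_ksec x)
}.

Section SupNorm.
Variables (R : realType) (D : Type).

(* [Normc.normc] is the modulus with values in [R]; the norm [`|z|] of
   [z : R[i]] lives in [R[i]]. *)
Definition sup_norm (f : D -> R[i]) : \bar R :=
  ereal_sup [set (ComplexField.Normc.normc (f x))%:E | x in [set: D]].

Definition bounded_functions : set (D -> R[i]) :=
  [set f | (sup_norm f < +oo)%E].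

(* K(x, x) is a nonnegative real for the kernel of an RKHS, so that taking its
   real part loses nothing. *)
Definition kernel_radius (K : D -> D -> R[i]) : \bar R :=
  ereal_sup [set (Num.sqrt (complex.Re (K x x)))%:E | x in [set: D]].

End SupNorm.

Section Widths.
Variables (R : realType) (D : Type) (K : D -> D -> R[i]) (H : rkhs K).

Definition unit_ball : set H := [set f : H | `|f| <= 1].

Definition bounded_linear_map n (N : {linear H -> 'rV[R[i]]_n}) : Prop :=
  exists M : R, forall f : H, `|N f| <= M%:C * `|f|.

Definition worst_case_error (A : H -> D -> R[i]) : \bar R :=
  ereal_sup [set sup_norm (fun x => rkhs_eval H f x - A f x) | f in unit_ball].

Definition gelfand_width (n : nat) : \bar R :=
  ereal_inf [set e | exists (N : {linear H -> 'rV[R[i]]_n})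
                            (psi : 'rV[R[i]]_n -> D -> R[i]),
    [/\ bounded_linear_map N,
        forall v, bounded_functions (psi v)
      & e = worst_case_error (fun f => psi (N f))]].

Definition linear_sampling_width (m : nat) : \bar R :=
  ereal_inf [set e | exists (x : 'I_m -> D)
                            (phi : {linear 'rV[R[i]]_m -> (D -> R[i])}),
    (forall v, bounded_functions (phi v)) /\
    e = worst_case_error (fun f => phi (\row_(i < m) rkhs_eval H f (x i)))].

End Widths.

(* Main.v *)
Require Import Defs.
From HB Require Import structures.
From mathcomp Require Import all_boot all_order all_algebra sesquilinear.
From mathcomp Require Import all_classical all_reals all_analysis.
From mathcomp Require Import complex.
From mathcomp Require Import spectral ring lra zify.
Import Order.TTheory GRing.Theory Num.Theory.
Import numFieldNormedType.Exports.
Local Open Scope classical_set_scope.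
Local Open Scope ring_scope.

Set Implicit Arguments.
Unset Strict Implicit.
Unset Printing Implicit Defensive.

(* In both widths only the kernel sections k_x matter. If N f = 0 and |f| <= 1,
   then f and - f carry the same information, so any algorithm using N has error
   at least |<f, k_x>|: a Gelfand width bounds the norm of the k_x as functionals
   on the kernel of N. Conversely, orthogonal projection onto the span of
   k_(x_1), ..., k_(x_n) is linear in the values f(x_i), and its error is
   sigma_n = sup_x dist(k_x, span). The points are chosen by a weak greedy rule:
   each is farthest, up to a factor 2, from the span of the previous ones.
   Comparing the determinant of the triangular matrix of 2m consecutive greedy
   sections with the Gelfand information (as DeVore, Petrova and Wojtaszczyk do
   for Kolmogorov widths) gives sigma_(n+2m)^2 <= 8 sigma_n c_m, and every rate
   whose values at n and 8n are comparable propagates through this recursion with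
   m ~ n/4. *)

(** * Determinant inequalities for complex matrices *)

Section Det.
Local Open Scope sesquilinear_scope.
Variable C : numClosedFieldType.

Lemma normsq_det_unitary n (Q : 'M[C]_n) : Q \is unitarymx -> `|\det Q| ^+ 2 = 1.
Proof.
move=> /unitarymxP /(congr1 determinant).
by rewrite det_mulmx det1 det_map_mx det_tr normCK.
Qed.

Lemma dotmx_sum n (u v : 'rV[C]_n) : dotmx u v = \sum_i u 0 i * (v 0 i)^*.
Proof. by rewrite dotmxE mxE; apply: eq_bigr => i _; rewrite !mxE. Qed.

Lemma dotmx_row_unitary m n p (A : 'M[C]_(m, n)) (Q : 'M[C]_(p, n)) i j :
  (A *m Q^t*) i j = dotmx (row i A) (row j Q).
Proof. by rewrite dotmx_sum mxE; apply: eq_bigr => l _; rewrite !mxE. Qed.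

Lemma dotmx_mulmx_unitary n p (u v : 'rV[C]_p) (Q : 'M[C]_(p, n)) :
  Q \is unitarymx -> dotmx (u *m Q) (v *m Q) = dotmx u v.
Proof.
move=> Qu; rewrite !dotmxE trmx_mul map_mxM mulmxA -[u *m Q *m _]mulmxA.
by rewrite (unitarymxP Qu) mulmx1.
Qed.

(** Orthonormalising the rows gives [A = L *m Q] with [L] lower triangular and [Q] unitary; a
    diagonal entry of [L] is at most the length of its row, which [Q] preserves. *)
Lemma hadamard n (A : 'M[C]_n) :
  `|\det A| ^+ 2 <= \prod_i dotmx (row i A) (row i A).
Proof.
set Q := schmidt A; have Qu : Q \is unitarymx by exact: schmidt_unitarymx.
pose L := A *m Q^t*.
have AE : A = L *m Q by rewrite /L mulmxKtV.
have Ltrig : is_trig_mx L.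
  apply/is_trig_mxP => i j ij; rewrite dotmx_row_unitary.
  have /sub_sumsmxP [u ->] := row_schmidt_sub A i.
  rewrite linear_sumlz /= big1 // => l li.
  have /sub_rVP [a ->] : (u l *m <<row l Q>> <= row l Q)%MS.
    by rewrite (submx_trans (submxMl _ _)) ?genmxE.
  rewrite linearZl_LR /= (row_unitarymxP Qu).
  by rewrite -val_eqE ltn_eqF ?mulr0// (leq_ltn_trans li).
have -> : `|\det A| ^+ 2 = \prod_i `|L i i| ^+ 2.
  rewrite {1}AE det_mulmx normrM exprMn [X in _ * X]normsq_det_unitary // mulr1.
  by rewrite det_trig // normr_prod prodrXl.
apply: ler_prod => i _; rewrite exprn_ge0 //=.
have -> : row i A = row i L *m Q by rewrite -row_mul -AE.
rewrite dotmx_mulmx_unitary // dotmx_sum (bigD1 i) //=.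
rewrite [row i L 0 i]mxE normCK lerDl.
by apply: sumr_ge0 => j _; rewrite mul_conjC_ge0.
Qed.

Lemma prod_le_mean n (x : 'I_n -> C) (a : C) :
  (forall j, 0 <= x j) -> \sum_j x j <= a *+ n -> \prod_j x j <= a ^+ n.
Proof.
case: n x => [x _ _|n x x0 xa]; first by rewrite big_ord0 expr0.
have le_agm : \prod_j x j <= ((\sum_j x j) / n.+1%:R) ^+ n.+1.
  have /leifP := @leif_AGM _ _ predT x (fun j _ => x0 j).
  by rewrite cardT size_enum_ord; case: ifP => _ => [/eqP ->|/ltW].
have sum0 : 0 <= \sum_j x j by apply: sumr_ge0.
have mean_a : (\sum_j x j) / n.+1%:R <= a.
  by rewrite ler_pdivrMr ?ltr0n// mulr_natr.
have mean0 : 0 <= (\sum_j x j) / n.+1%:R by rewrite divr_ge0.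
apply: le_trans le_agm _; apply: lerXn2r => //; rewrite nnegrE//.
exact: le_trans mean_a.
Qed.

(** By rank-nullity the left kernel of [M] has dimension at least [k]; an orthonormal basis of a
    [k]-dimensional part of it is completed to the whole space. *)
Lemma unitary_kernel_rows k m (M : 'M[C]_(k + m, m)) :
  exists2 Q : 'M[C]_(k + m), Q \is unitarymx & usubmx Q *m M = 0.
Proof.
have kr : (k <= \rank (kermx M))%N.
  by rewrite mxrank_ker leq_subRL ?rank_leq_row// addnC leq_add2l rank_leq_col.
pose V : 'M[C]_(k, k + m) := pid_mx k *m row_base (kermx M).
have rV : \rank V = k by rewrite mxrankMfree ?row_base_free// rank_pid_mx.
have VM : V *m M = 0.
  apply/sub_kermxP; rewrite (submx_trans (submxMl _ _))//.
  by rewrite eq_row_base.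
(* Padding by zero rows lets [schmidt] complete the orthonormalised rows of [V] to a square unitary
   matrix. *)
pose B : 'M[C]_(k + m) := col_mx V 0; pose Q := schmidt B.
have Qu : Q \is unitarymx by exact: schmidt_unitarymx.
exists Q => //.
have VQ : (V <= usubmx Q)%MS.
  apply/row_subP => i; have := row_schmidt_sub B (lshift m i).
  rewrite rowKu => /submx_trans; apply; apply/sumsmx_subP => l /= li.
  have lk : (l < k)%N by rewrite (leq_ltn_trans li).
  have -> : l = lshift m (Ordinal lk) by exact/val_inj.
  by rewrite genmxE -row_usubmx row_sub.
have QV : (usubmx Q <= V)%MS.
  by rewrite -(geq_leqif (mxrank_leqif_sup VQ)) rV rank_leq_row.
by apply/sub_kermxP; rewrite (submx_trans QV)//; apply/sub_kermxP.
Qed.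

(* Scaling the two blocks of columns of [A], written in a unitary basis adapted
   to the kernel of [M], makes every row of squared length at most 2; Hadamard's
   inequality for the columns and AM-GM do the rest. *)
Lemma det_bound_kernel k m (A : 'M[C]_(k + m)) (M : 'M[C]_(k + m, m)) (S E : C) :
    0 < S -> 0 < E ->
    (forall i, dotmx (row i A) (row i A) <= S) ->
    (forall u : 'rV_(k + m), u *m M = 0 ->
       forall i, `|dotmx u (row i A)| ^+ 2 <= E * dotmx u u) ->
  `|\det A| ^+ 2 <= 2 ^+ (k + m) * (E ^+ k * S ^+ m).
Proof.
move=> S0 E0 AS AE.
have [Q Qu QM] := unitary_kernel_rows M.
pose B := A *m Q^t*.
have detB : `|\det A| ^+ 2 = `|\det B^T| ^+ 2.
  rewrite det_tr /B det_mulmx normrM exprMn.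
  by rewrite [X in _ * X]normsq_det_unitary ?mulr1// trmxC_unitary.
have rowA i : row i A = row i B *m Q.
  by rewrite -row_mul /B mulmxKtV.
pose w (j : 'I_(k + m)) := if (j < k)%N then E^-1 else S^-1.
have w0 j : 0 <= w j by rewrite /w; case: ifP => _; rewrite invr_ge0 ltW.
pose c j := \sum_i `|B i j| ^+ 2.
have c0 j : 0 <= c j by apply: sumr_ge0 => i _; rewrite exprn_ge0.
have prodw : (\prod_j w j) * (E ^+ k * S ^+ m) = 1.
  rewrite big_split_ord /=.
  under eq_bigr do rewrite /w /= ltn_ord.
  under [X in _ * X * _]eq_bigr do rewrite /w /= ltnNge leq_addr /=.
  rewrite !prodr_const !card_ord mulrACA -!exprMn !mulVf ?gt_eqF//.
  by rewrite !expr1n mulr1.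
have had : `|\det A| ^+ 2 <= \prod_j c j.
  rewrite detB (le_trans (hadamard _))// ler_prod// => j _.
  rewrite dnorm_ge0 /= dotmx_sum; apply: ler_sum => i _.
  by rewrite !mxE normCK.
have rowE i : \sum_(j < k) `|B i (lshift m j)| ^+ 2 <= E.
  (* In the basis [Q], [x] is the first block of row [i] of [B]. So [x *m Q] kills [M], and its
     product with row [i] of [A] is its own squared length [X]: hence [X ^+ 2 <= E * X]. *)
  pose x : 'rV_(k + m) := row_mx (lsubmx (row i B)) 0.
  set X := \sum_(j < k) _.
  have X0 : 0 <= X by apply: sumr_ge0 => j _; rewrite exprn_ge0.
  have xM : x *m Q *m M = 0.
    by rewrite -mulmxA -[Q]vsubmxK mul_col_mx mul_row_col QM mulmx0 mul0mx addr0.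
  have xx : dotmx x x = X.
    rewrite dotmx_sum big_split_ord /= [X in _ + X]big1 ?addr0.
      by apply: eq_bigr => j _; rewrite !row_mxEl !mxE normCK.
    by move=> j _; rewrite row_mxEr mxE mul0r.
  have xB : dotmx x (row i B) = X.
    rewrite dotmx_sum big_split_ord /= [X in _ + X]big1 ?addr0.
      by apply: eq_bigr => j _; rewrite !row_mxEl !mxE normCK.
    by move=> j _; rewrite row_mxEr mxE mul0r.
  have := AE _ xM i; rewrite rowA !dotmx_mulmx_unitary // xx xB ger0_norm//.
  have [X_eq0|Xn0] := eqVneq X 0; [by rewrite X_eq0 (ltW E0)|].
  by rewrite expr2 ler_pM2r // lt_def Xn0.
have rowS i : \sum_j `|B i j| ^+ 2 <= S.
  apply: le_trans (AS i); rewrite rowA dotmx_mulmx_unitary // dotmx_sum.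
  by apply: ler_sum => j _; rewrite [row i B 0 j]mxE normCK.
have row2 i : \sum_j w j * `|B i j| ^+ 2 <= 2.
  rewrite big_split_ord /= -[2]/(1 + 1); apply: lerD.
    under eq_bigr do rewrite /w /= ltn_ord.
    by rewrite -mulr_sumr mulrC ler_pdivrMr// mul1r rowE.
  under eq_bigr do rewrite /w /= ltnNge leq_addr /=.
  rewrite -mulr_sumr mulrC ler_pdivrMr// mul1r (le_trans _ (rowS i))//.
  by rewrite [leRHS]big_split_ord /= lerDr sumr_ge0// => j _; rewrite exprn_ge0.
have agm : \prod_j (w j * c j) <= 2 ^+ (k + m).
  have wc0 j : 0 <= w j * c j by rewrite mulr_ge0.
  apply: prod_le_mean => //; under eq_bigr do rewrite /c mulr_sumr.
  rewrite exchange_big /= -[in leRHS](card_ord (k + m)) -sumr_const.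
  exact: ler_sum.
have ES0 : 0 <= E ^+ k * S ^+ m by rewrite mulr_ge0 ?exprn_ge0 ?ltW.
have := ler_wpM2r ES0 agm; rewrite big_split /= mulrAC prodw mul1r.
exact: le_trans had.
Qed.

End Det.

(** * Gram-Schmidt residuals for an inner product *)

Section Residual.
Local Open Scope sesquilinear_scope.
Variables (C : numClosedFieldType) (U : lmodType C).
Variable form : {dot U for (@Num.conj C)}.

Local Notation "''[' u , v ]" := (form u%R v%R) : ring_scope.
Local Notation "''[' u ]" := '[u, u]%R : ring_scope.

Lemma dot_conjC u v : '[u, v] = '[v, u]^*.
Proof. by rewrite hermC expr0 mul1r. Qed.

Lemma dotZl a u v : '[a *: u, v] = a * '[u, v].
Proof. exact: linearZl_LR. Qed.

Lemma dotZr a u v : '[u, a *: v] = a^* * '[u, v].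
Proof. exact: linearZr_LR. Qed.

Lemma dotBl u v w : '[u - v, w] = '[u, w] - '[v, w].
Proof. exact: linearBl. Qed.

Lemma dotBr u v w : '[u, v - w] = '[u, v] - '[u, w].
Proof. exact: linearBr. Qed.

Lemma dot0r u : '[u, 0] = 0.
Proof. exact: linear0r. Qed.

Lemma dot_suml n (F : 'I_n -> U) u :
  '[\sum_(i < n) F i, u] = \sum_(i < n) '[F i, u].
Proof. exact: linear_sumlz. Qed.

Lemma dot_sumr n (F : 'I_n -> U) u :
  '[u, \sum_(i < n) F i] = \sum_(i < n) '[u, F i].
Proof. exact: linear_sumr. Qed.

Lemma cauchy_schwarz u v : `|'[u, v]| ^+ 2 <= '[u] * '[v].
Proof.
have [->|v0] := eqVneq v 0; first by rewrite !dot0r normr0 expr0n mulr0.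
have vp : 0 < '[v] by rewrite dnorm_gt0.
have vr : '[v]^* = '[v] by rewrite -dot_conjC.
have := dnorm_ge0 form (u - ('[u, v] / '[v]) *: v).
rewrite dotBl /= !dotBr /= !dotZl /= !dotZr /=.
rewrite rmorphM fmorphV /= vr (dot_conjC v u) normCK.
set a := '[u, v]; set b := '[v]; set c := '[u] => H; rewrite -subr_ge0.
have -> : c * b - a * a^* =
    (c - a^* / b * a - (a / b * a^* - a / b * (a^* / b * b))) * b.
  by field; rewrite /b gt_eqF.
by rewrite mulr_ge0// ltW.
Qed.

(* A vanishing v i contributes nothing because 0^-1 = 0, so a greedy sequence may
   be continued after the residuals have become zero. *)
Definition resid (v : nat -> U) n (f : U) : U :=
  f - \sum_(i < n) ('[f, v i] / '[v i]) *: v i.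

Lemma residS v n f :
  resid v n.+1 f = resid v n f - ('[f, v n] / '[v n]) *: v n.
Proof. by rewrite /resid big_ord_recr opprD addrA. Qed.

Section Orthogonal.
Variables (k v : nat -> U).
Hypothesis vE : forall n, v n = resid v n (k n).

Lemma divf_dnorm (u w : U) : '[u, w] / '[w] * '[w] = '[u, w].
Proof.
have [->|w0] := eqVneq w 0; first by rewrite !dot0r mulr0.
by rewrite divfK// dnorm_eq0.
Qed.

(** Orthogonality is assumed only below [n], so that this can drive the strong induction proving it
    for all indices. *)
Lemma resid_orth_of n :
    (forall i j, (i < j < n)%N -> '[v i, v j] = 0) ->
  forall f i, (i < n)%N -> '[resid v n f, v i] = 0.
Proof.
move=> vo f i ltin; rewrite dotBl dot_suml.
rewrite (bigD1 (Ordinal ltin)) //=.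
rewrite dotZl /= divf_dnorm big1 ?addr0 ?subrr// => j.
rewrite -val_eqE /= => ji; rewrite dotZl /=.
have [lt_ij|lt_ji|eq_ij] := ltngtP i j; last by rewrite eq_ij eqxx in ji.
  by rewrite (dot_conjC (v j) (v i)) (vo i j) ?lt_ij ?ltn_ord// conjC0 mulr0.
by rewrite (vo j i) ?lt_ji// mulr0.
Qed.

Lemma gram_schmidt_orth i j : (i < j)%N -> '[v i, v j] = 0.
Proof.
elim/ltn_ind: j i => j IH i lt_ij.
rewrite dot_conjC [v j]vE resid_orth_of ?conjC0// => a b /andP[ab bj].
exact: IH.
Qed.

Lemma gram_schmidt_orthN i j : i != j -> '[v i, v j] = 0.
Proof.
rewrite neq_ltn => /orP[|] ij; first exact: gram_schmidt_orth.
by rewrite dot_conjC gram_schmidt_orth// conjC0.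
Qed.

Lemma resid_orth n f i : (i < n)%N -> '[resid v n f, v i] = 0.
Proof. by apply: resid_orth_of => a b /andP[ab _]; exact: gram_schmidt_orth. Qed.

Lemma form_resid_ge n f i : (n <= i)%N -> '[resid v n f, v i] = '[f, v i].
Proof.
move=> le_ni; rewrite dotBl /= dot_suml /= big1 ?subr0// => j _.
by rewrite dotZl /= (@gram_schmidt_orth j i) ?mulr0// (leq_trans (ltn_ord j)).
Qed.

Lemma form_resid_resid n f g : '[resid v n f, resid v n g] = '[resid v n f, g].
Proof.
rewrite {2}/resid dotBr /= dot_sumr /= big1 ?subr0// => j _.
by rewrite dotZr /= resid_orth ?mulr0.
Qed.

(** The residual map is an orthogonal projection: both sides equal ['[resid v n f, resid v n g]]. *)
Lemma resid_selfadjoint n f g : '[resid v n f, g] = '[f, resid v n g].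
Proof.
rewrite [RHS]dot_conjC -form_resid_resid.
by rewrite -(form_resid_resid n g f) -dot_conjC.
Qed.

(** Pythagoras: passing from [n] to [n + p] removes the components along the orthogonal vectors
    [v n, ..., v (n + p - 1)]. *)
Lemma dnorm_resid_add n p f :
  '[resid v n f] =
  '[resid v (n + p) f] + \sum_(i < p) `|'[f, v (n + i)]| ^+ 2 / '[v (n + i)].
Proof.
elim: p => [|p IH]; first by rewrite addn0 big_ord0 addr0.
have step : '[resid v (n + p).+1 f, f] =
    '[resid v (n + p) f, f] - `|'[f, v (n + p)]| ^+ 2 / '[v (n + p)].
  rewrite residS dotBl /= dotZl /=.
  by rewrite (dot_conjC (v (n + p)%N) f) normCK mulrAC.
rewrite IH addnS !(form_resid_resid _ f f) step big_ord_recr /= [in RHS]addrCA.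
by rewrite subrK addrC.
Qed.

Lemma dnorm_resid_le n p f : '[resid v (n + p) f] <= '[resid v n f].
Proof.
rewrite [leRHS](dnorm_resid_add n p) lerDl sumr_ge0// => i _.
by rewrite divr_ge0 ?exprn_ge0 ?dnorm_ge0.
Qed.

(** The projection of [f] is linear in its values against the [k i]: by self-adjointness,
    ['[f, v n]] is ['[f, k n]] minus the value against [k n] of the projection already built. *)
Lemma resid_interpolation n :
  exists h : nat -> U, forall f, f - resid v n f = \sum_(i < n) '[f, k i] *: h i.
Proof.
elim: n => [|n [h hE]].
  by exists (fun=> 0) => f; rewrite /resid !big_ord0 subr0 subrr.
pose g := '[v n]^-1 *: v n.
exists (fun i => if (i < n)%N then h i - '[h i, k n] *: g else g) => f.
rewrite big_ord_recr /= ltnn residS opprB addrCA hE addrC.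
under eq_bigr => i _ do rewrite ltn_ord scalerBr scalerA.
rewrite sumrB -scaler_suml -addrA; congr (_ + _).
have -> : '[f, v n] = '[f, k n] - \sum_(i < n) '[f, k i] * '[h i, k n].
  rewrite vE -resid_selfadjoint -[in LHS](subKr f (resid v n f)) hE.
  by rewrite dotBl dot_suml /=; under eq_bigr do rewrite dotZl.
by rewrite -scalerA -/g scalerBl addrC.
Qed.

End Orthogonal.

(* The matrix of the k's in the orthonormal basis obtained by normalising the v's
   is triangular, with the lengths of the v's on the diagonal. *)
Lemma prod_dnorm_le (k v : nat -> U) n m p (L : {linear U -> 'rV[C]_m})
    (S E : C) :
    (forall n, v n = resid v n (k n)) -> 0 < S -> 0 < E ->
    (forall i, '[resid v n (k i)] <= S) ->
    (forall u, L u = 0 -> forall i, `|'[u, k i]| ^+ 2 <= E * '[u]) ->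
  \prod_(i < p + m) '[v (n + i)] <= 2 ^+ (p + m) * (E ^+ p * S ^+ m).
Proof.
move=> vE S0 E0 kS LE.
(* A vanishing factor makes the product zero; otherwise every [v (n + i)] can be normalised. *)
case: (pickP (fun i : 'I_(p + m) => v (n + i) == 0)) => [i /eqP vi0|vn0].
  rewrite (bigD1 i) //= vi0 dot0r mul0r.
  by rewrite !mulr_ge0 ?exprn_ge0// ltW.
pose nv i := sqrtC '[v (n + i)].
have nv0 (i : 'I_(p + m)) : 0 < nv i.
  by rewrite sqrtC_gt0 dnorm_gt0; apply/negbT/vn0.
have nvV (i : 'I_(p + m)) : ((nv i)^-1)^* = (nv i)^-1.
  by rewrite conj_Creal// realV ger0_real// ltW.
have nv2 i : nv i ^+ 2 = '[v (n + i)] by rewrite sqrtCK.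
pose e i := (nv i)^-1 *: v (n + i).
pose A := \matrix_(i < p + m, j < p + m) '[k (n + i), e j].
pose M := \matrix_(i < p + m) L (e i).
have ke i (j : 'I_(p + m)) : '[k i, e j] = (nv j)^-1 * '[k i, v (n + j)%N].
  by rewrite dotZr /= nvV.
have eo (i j : 'I_(p + m)) : '[e i, e j] = (i == j)%:R.
  rewrite dotZr dotZl /= nvV.
  have [->|ij] := eqVneq i j.
    by rewrite -nv2 mulr1n; field; rewrite gt_eqF.
  by rewrite (@gram_schmidt_orthN k _ vE (n + i) (n + j)) ?mulr0// eqn_add2l.
have detA : `|\det A| ^+ 2 = \prod_(i < p + m) '[v (n + i)].
  rewrite det_trig.
    rewrite normr_prod -prodrXl; apply: eq_bigr => i _.
    rewrite mxE ke -(form_resid_ge vE _ (leqnn _)) -vE -nv2 expr2 mulrA.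
    by rewrite mulVf ?gt_eqF// mul1r ger0_norm// ltW.
  apply/is_trig_mxP => i j ij; rewrite mxE ke.
  have nij : (n + i < n + j)%N by rewrite ltn_add2l.
  by rewrite -(form_resid_ge vE _ (ltnW nij)) -vE (gram_schmidt_orth vE)// mulr0.
rewrite -detA; apply: (det_bound_kernel (M := M)) => //.
  (* Bessel's inequality for the residual at stage [n]: this is why [S] has to bound only these
     residuals and not the full vectors [k i]. *)
  move=> i; apply: le_trans (kS (n + i)%N).
  rewrite (dnorm_resid_add vE n (p + m)).
  rewrite dotmx_sum; under eq_bigr do rewrite !mxE -normCK ke.
  rewrite ler_wpDl ?dnorm_ge0//; apply: ler_sum => j _.
  rewrite normrM exprMn mulrC ler_wpM2l ?exprn_ge0//.
  by rewrite normfV exprVn ger0_norm ?nv2// ltW.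
(* A coefficient vector in the kernel of [M] is a vector of the same length in the kernel of [L]. *)
move=> u uM i; pose f := \sum_(j < p + m) u 0 j *: e j.
have Lf : L f = 0.
  rewrite -uM mulmx_sum_row /f linear_sum /=.
  by apply: eq_bigr => j _; rewrite linearZ rowK.
have -> : dotmx u u = '[f].
  rewrite dotmx_sum {1}/f dot_suml /=; apply: eq_bigr => j _.
  rewrite dotZl /f dot_sumr /= (bigD1 j) //= dotZr /= eo eqxx.
  rewrite mulr1 big1 ?addr0// => l lj.
  by rewrite dotZr /= eo eq_sym (negPf lj) mulr0.
have -> : dotmx u (row i A) = '[f, k (n + i)].
  rewrite dotmx_sum /f dot_suml /=; apply: eq_bigr => j _.
  by rewrite dotZl !mxE -dot_conjC.
exact: LE.
Qed.

End Residual.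

Section LinComb.
Variables (F : pzRingType) (U : lmodType F) (n : nat) (h : 'I_n -> U).
(** Packaged as a linear map because a sampling algorithm must be one. *)
Definition lincomb (c : 'rV[F]_n) : U := \sum_i c 0 i *: h i.
Fact lincomb_is_linear : linear lincomb.
Proof.
move=> a c d; rewrite /lincomb scaler_sumr -big_split /=.
by apply: eq_bigr => i _; rewrite !mxE scalerDl scalerA.
Qed.
HB.instance Definition _ :=
  GRing.isLinear.Build F 'rV[F]_n U _ lincomb lincomb_is_linear.
End LinComb.

(** The supremum need not be attained, but a point above 3/4 of it is enough. Here [rho] will be a
    squared distance, so the factor 4 is a factor 2 for distances. *)
Lemma ex_half_maximal (R : realType) (D : Type) (rho : D -> R) (B : R) :
    [set: D] !=set0 -> (forall y, 0 <= rho y <= B) ->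
  exists x, forall y, rho y <= 4 * rho x.
Proof.
move=> [d _] rhoB.
have hs : has_sup (range rho).
  split; first by exists (rho d), d.
  by exists B => _ [y _ <-]; have /andP[] := rhoB y.
have ub y : rho y <= sup (range rho) by apply: ub_le_sup; [case: hs|exists y].
have [s0|s_gt0] := leP (sup (range rho)) 0.
  exists d => y; have := ub y; have /andP[] := rhoB d; lra.
have [|_ [x _ <-] lt_x] :=
  @sup_adherent R (range rho) (3 / 4 * sup (range rho)) _ hs.
  lra.
by exists x => y; have := ub y; lra.
Qed.

(** * Greedy sampling in the kernel space *)

Section RKHS.
Local Open Scope complex_scope.
Variables (R : realType) (D : Type) (K : D -> D -> R[i]) (H : rkhs K).
Local Notation ip := (rkhs_ip H).
Local Notation k := (rkhs_ksec H).

Lemma normc_realC (z : R[i]) : `|z| = (ComplexField.Normc.normc z)%:C.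
Proof. by case: z. Qed.

(** Real-valued, so that suprema and square roots can be taken in [R]. *)
Definition sqnorm (f : H) : R := complex.Re (ip f f).

Lemma sqnormE f : ip f f = (sqnorm f)%:C.
Proof. by rewrite RRe_real// ger0_real ?dnorm_ge0. Qed.

Lemma sqnorm_ge0 f : 0 <= sqnorm f.
Proof. by rewrite -ler0c -sqnormE dnorm_ge0. Qed.

Lemma normc_eval_le f y :
  ComplexField.Normc.normc (rkhs_eval H f y) ^+ 2 <= sqnorm f * sqnorm (k y).
Proof.
rewrite rkhs_reproducing -lecR rmorphXn rmorphM /= -normc_realC -!sqnormE.
exact: cauchy_schwarz.
Qed.

Lemma unit_ball_sqnorm f : unit_ball f -> sqnorm f <= 1.
Proof.
rewrite /unit_ball /= => f1; rewrite -lecR -sqnormE -rkhs_normE.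
by rewrite expr_le1.
Qed.

Lemma kernel_radiusP : [set: D] !=set0 -> (kernel_radius K < +oo)%E ->
  exists r : R, [/\ kernel_radius K = r%:E, 0 <= r &
    forall y, sqnorm (k y) <= r ^+ 2].
Proof.
move=> [d _] Kfin; pose q y := Num.sqrt (complex.Re (K y y)).
have ub y : ((q y)%:E <= kernel_radius K)%E by apply: ereal_sup_ubound; exists y.
have Kr : kernel_radius K = (fine (kernel_radius K))%:E.
  by rewrite fineK// ge0_fin_numE// (le_trans _ (ub d))// lee_fin sqrtr_ge0.
exists (fine (kernel_radius K)); split=> //.
  by rewrite -lee_fin -Kr (le_trans _ (ub d))// lee_fin sqrtr_ge0.
move=> y; have := ub y; rewrite Kr lee_fin => qr.
have Ks : complex.Re (K y y) = sqnorm (k y).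
  by rewrite /sqnorm -rkhs_reproducing rkhs_ksecE.
rewrite -Ks -[leLHS]sqr_sqrtr ?Ks ?sqnorm_ge0//.
by rewrite -Ks ler_pXn2r ?nnegrE ?sqrtr_ge0// (le_trans _ qr) ?sqrtr_ge0.
Qed.

Lemma sup_norm_leP (f : D -> R[i]) (s : R) :
  (sup_norm f <= s%:E)%E <-> forall y, ComplexField.Normc.normc (f y) <= s.
Proof.
split=> [fs y|fs].
  by rewrite -lee_fin (le_trans _ fs)//; apply: ereal_sup_ubound; exists y.
by apply: ge_ereal_sup => _ [y _ <-]; rewrite lee_fin.
Qed.

(* Both u and - u carry the information 0, so the algorithm cannot do better than
   half of their distance. *)
Lemma gelfand_width_lt m (e : R) : [set: D] !=set0 ->
    (gelfand_width H m < e%:E)%E ->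
  exists N : {linear H -> 'rV[R[i]]_m}, forall u, N u = 0 -> forall y,
    `|ip u (k y)| ^+ 2 <= (e ^+ 2)%:C * ip u u.
Proof.
move=> [d _] /ereal_inf_lt[_ [N [psi [_ _ ->]]] err]; exists N => u Nu y.
have errP f : unit_ball f -> forall y,
    ComplexField.Normc.normc (rkhs_eval H f y - psi (N f) y) <= e.
  move=> f1; apply/sup_norm_leP; rewrite (le_trans _ (ltW err))//.
  by apply: ereal_sup_ubound; exists f.
have [->|u0] := eqVneq u 0.
  by rewrite !linear0l normr0 expr0n mulr0.
have nu0 : 0 < `|u| by rewrite normr_gt0.
pose f := `|u|^-1 *: u.
have f1 : unit_ball f.
  rewrite /unit_ball /= normrZ normfV ger0_norm ?normr_ge0//.
  by rewrite mulVf// normr_eq0.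
have fN1 : unit_ball (- f) by rewrite /unit_ball /= normrN.
have Nf : N f = 0 by rewrite linearZ /= Nu scaler0.
have NfN : N (- f) = 0 by rewrite linearN Nf oppr0.
have fe : `|rkhs_eval H f y| <= e%:C.
  have := errP _ f1 y; have := errP _ fN1 y; rewrite Nf NfN linearN.
  set a := rkhs_eval H f y; set p := psi 0 y.
  rewrite -!lecR -!normc_realC fctE -/a => h1 h2.
  rewrite -(ler_pM2l (ltr0Sn _ 1)) -normr_nat -normrM mulrC mulr_natr mulr2n.
  have -> : a + a = (a - p) - (- a - p) by ring.
  by rewrite (le_trans (ler_normB _ _))// normr_nat mulr_natl mulr2n lerD.
have -> : u = `|u| *: f by rewrite scalerA mulfV ?scale1r// gt_eqF.
rewrite linearZl_LR /= -rkhs_reproducing normrM dnormZ normr_id.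
rewrite exprMn [leRHS]mulrCA ler_wpM2l ?exprn_ge0//.
rewrite -rkhs_normE.
have -> : `|f| = 1.
  by rewrite normrZ normfV ger0_norm ?normr_ge0// mulVf// normr_eq0.
rewrite expr1n mulr1 rmorphXn /= ler_pXn2r ?nnegrE ?normr_ge0//.
exact: le_trans fe.
Qed.

(** The state is the residual map itself, which carries all that matters of the points chosen so
    far; [x] selects the next point from the squared distances. *)
Definition greedy_step (x : (D -> R) -> D) (r : H -> H) : H -> H :=
  let w := r (k (x (fun y => sqnorm (r (k y))))) in
  fun f => r f - (ip f w / ip w w) *: w.

Lemma weak_greedy (B : R) : [set: D] !=set0 -> (forall y, sqnorm (k y) <= B) ->
  exists (x : nat -> D) (v : nat -> H),
    (forall n, v n = resid ip v n (k (x n))) /\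
    (forall n y, sqnorm (resid ip v n (k y)) <= 4 * sqnorm (v n)).
Proof.
move=> D0 kB; have [d _] := D0.
(* The selection is made total: a function outside the range from 0 to [B] gets the arbitrary point
   [d]. *)
have [|sel selP] := @choice _ _ (fun (rho : D -> R) x =>
    (forall y, 0 <= rho y <= B) -> forall y, rho y <= 4 * rho x).
  move=> rho.
  have [rhoB|nrhoB] := pselect (forall y, 0 <= rho y <= B); last by exists d.
  by have [x xP] := ex_half_maximal D0 rhoB; exists x.
pose r n := iter n (greedy_step sel) id.
pose x n := sel (fun y => sqnorm (r n (k y))).
pose v n := r n (k (x n)).
have rE n f : r n f = resid ip v n f.
  elim: n => [|n IH]; first by rewrite /resid big_ord0 subr0.
  by rewrite residS -IH.
have vE n : v n = resid ip v n (k (x n)) by rewrite -rE.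
exists x, v; split=> // n y; rewrite -rE.
apply: (selP (fun y => sqnorm (r n (k y)))) => {}y.
rewrite sqnorm_ge0 /= (le_trans _ (kB y))//.
rewrite -lecR -!sqnormE rE -[n]add0n.
apply: le_trans (dnorm_resid_le vE 0 n _) _.
by rewrite /resid big_ord0 subr0.
Qed.

(** The algorithm is the projection onto the span of the sampled sections. By self-adjointness its
    error at [y] is the product of [f] with the residual of [k y], to which Cauchy-Schwarz
    applies. *)
Lemma linear_sampling_width_le (x : nat -> D) (v : nat -> H) n (r s : R) :
    (forall i, v i = resid ip v i (k (x i))) ->
    (forall y, sqnorm (k y) <= r) -> 0 <= s ->
    (forall y, sqnorm (resid ip v n (k y)) <= s ^+ 2) ->
  (linear_sampling_width H n <= s%:E)%E.
Proof.
move=> vE kr s0 vs.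
have [h hE] := resid_interpolation vE n.
pose phi : {linear 'rV[R[i]]_n -> (D -> R[i])} :=
  rkhs_eval H \o lincomb (fun i : 'I_n => h i).
apply: (@le_trans _ _ (worst_case_error
    (fun f : H => phi (\row_(i < n) rkhs_eval H f (x i))))).
  apply: ereal_inf_lbound; exists (fun i : 'I_n => x i), phi; split=> // c.
  rewrite /bounded_functions /=; set g := lincomb _ c.
  apply: le_lt_trans (ltry (Num.sqrt (sqnorm g * r))).
  apply/sup_norm_leP => y; rewrite -[leLHS]ger0_norm.
    rewrite -sqrtr_sqr ler_wsqrtr// (le_trans (normc_eval_le g y))//.
    by rewrite ler_wpM2l ?sqnorm_ge0.
  by rewrite -ler0c -normc_realC.
apply: ge_ereal_sup => _ [f f1 <-]; apply/sup_norm_leP => y.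
have -> : rkhs_eval H f y - phi (\row_i rkhs_eval H f (x i)) y =
    ip f (resid ip v n (k y)).
  have -> : phi (\row_i rkhs_eval H f (x i)) = rkhs_eval H (f - resid ip v n f).
    rewrite hE /phi /= /lincomb; congr (rkhs_eval H _); apply: eq_bigr => i _.
    by rewrite mxE rkhs_reproducing.
  by rewrite !rkhs_reproducing -linearBl /= subKr (resid_selfadjoint vE).
rewrite -(ler_pXn2r (ltn0Sn 1)) ?nnegrE//; last first.
  by rewrite -ler0c -normc_realC.
rewrite -lecR rmorphXn /= -normc_realC (le_trans (cauchy_schwarz _ _ _))//.
rewrite !sqnormE -rmorphM lecR (le_trans _ (vs y))//.
by rewrite ler_piMl ?sqnorm_ge0// unit_ball_sqnorm.
Qed.

(** With [tau = sigma ^+ 2], the product of the [2m] squared residual lengths is at least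
    [(tau (n + 2m) / 4) ^+ 2m] and at most [(2 * e) ^+ 2m * tau n ^+ m]; the [2m]-th root gives the
    recursion. *)
Lemma greedy_rate (r : R) : [set: D] !=set0 -> 0 <= r ->
    (forall y, sqnorm (k y) <= r ^+ 2) ->
  exists sigma : nat -> R,
    [/\ forall n, 0 <= sigma n <= r,
        forall n, (linear_sampling_width H n <= (sigma n)%:E)%E &
        forall n m e, (0 < m)%N -> 0 < e -> (gelfand_width H m < e%:E)%E ->
          sigma (n + (m + m))%N ^+ 2 <= 8 * sigma n * e].
Proof.
move=> D0 r0 kr; have [d _] := D0.
have [x [v [vE vmax]]] := weak_greedy D0 kr.
pose rho n y := sqnorm (resid ip v n (k y)).
have rho_mono n p y : rho (n + p)%N y <= rho n y.
  by rewrite -lecR -!sqnormE (dnorm_resid_le vE).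
have rho_r n y : rho n y <= r ^+ 2.
  rewrite -[n]add0n (le_trans (rho_mono _ _ _))//.
  by rewrite /rho /resid big_ord0 subr0.
pose tau n := sup (range (rho n)).
have hs n : has_sup (range (rho n)).
  by split; [exists (rho n d), d|exists (r ^+ 2) => _ [y _ <-]].
have rho_tau n y : rho n y <= tau n.
  by apply: ub_le_sup; [case: (hs n)|exists y].
have tau_le n s : (forall y, rho n y <= s) -> tau n <= s.
  by move=> rs; apply: ge_sup => [|_ [y _ <-]//]; case: (hs n).
have tau0 n : 0 <= tau n by apply: le_trans (rho_tau n d); exact: sqnorm_ge0.
have tau_mono i j : (i <= j)%N -> tau j <= tau i.
  move=> /subnKC <-; apply: tau_le => y.
  by rewrite (le_trans (rho_mono _ _ _)).
have tau_v n : tau n <= 4 * sqnorm (v n) by apply: tau_le => y; exact: vmax.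
exists (fun n => Num.sqrt (tau n)); split=> [n|n|n m e m0 e0 em].
- by rewrite sqrtr_ge0 /= -[leRHS]ger0_norm// -sqrtr_sqr ler_wsqrtr// tau_le.
- apply: (linear_sampling_width_le vE kr) => [|y]; first exact: sqrtr_ge0.
  by rewrite sqr_sqrtr//; exact: rho_tau.
rewrite sqr_sqrtr//.
have [tau_n0|tau_n0] := eqVneq (tau n) 0.
  rewrite tau_n0 sqrtr0 mulr0 mul0r.
  by rewrite -tau_n0 tau_mono ?leq_addr.
have tau_n : 0 < tau n by rewrite lt_def tau_n0 tau0.
have [N NP] := gelfand_width_lt D0 em.
have S0 : 0 < (tau n)%:C by rewrite ltcR.
have E0 : 0 < (e ^+ 2)%:C by rewrite ltcR exprn_gt0.
have kS i : ip (resid ip v n (k (x i))) (resid ip v n (k (x i))) <= (tau n)%:C.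
  by rewrite sqnormE lecR; exact: rho_tau.
have prodv : \prod_(i < m + m) sqnorm (v (n + i)%N) <=
    2 ^+ (m + m) * ((e ^+ 2) ^+ m * tau n ^+ m).
  rewrite -lecR rmorph_prod !rmorphM !rmorphXn rmorph_nat /=.
  under eq_bigr do rewrite -sqnormE.
  rewrite -[_ ^+ 2]rmorphXn.
  exact: (@prod_dnorm_le _ _ ip (fun i => k (x i)) v n m m N _ _ vE S0 E0 kS
    (fun u Nu i => NP u Nu (x i))).
have lb : (tau (n + (m + m))%N / 4) ^+ (m + m) <=
    \prod_(i < m + m) sqnorm (v (n + i)%N).
  rewrite -[X in _ ^+ X]card_ord -prodr_const; apply: ler_prod => i _.
  rewrite divr_ge0//= ler_pdivrMr// mulrC (le_trans _ (tau_v _))//.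
  by rewrite tau_mono// leq_add2l ltnW.
have e_ge0 : 0 <= e by exact: ltW.
have := le_trans lb prodv.
rewrite -exprMn addnn -mul2n !exprM -exprMn.
rewrite ler_pXn2r ?nnegrE ?mulr_ge0 ?exprn_ge0 ?divr_ge0//.
have tE : tau n = Num.sqrt (tau n) ^+ 2 by rewrite sqr_sqrtr.
rewrite [in leRHS]tE -!exprMn ler_pXn2r ?nnegrE ?mulr_ge0 ?sqrtr_ge0 ?divr_ge0//.
by move=> ?; lra.
Qed.

End RKHS.

(** * From the recursion to decay rates *)

Lemma rate_of_recursion (R : realType) (sigma phi : nat -> R) (M C : R) n0 :
    (0 < n0)%N -> 0 <= M -> 0 <= C -> (forall n, 0 <= phi n) ->
    (forall n, 0 <= sigma n <= M) ->
    (forall n m, (n0 <= m)%N ->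
       sigma (n + (m + m))%N ^+ 2 <= 8 * sigma n * (M * phi m)) ->
    (forall n, (n0 <= n < 4 * n0)%N -> 1 <= C * phi n) ->
    (forall n N m, (n0 <= m)%N -> (n = N + (m + m))%N -> (n <= N.*2)%N ->
       (n < 4 * m.+1)%N -> 8 * (phi N * phi m) <= C * phi n ^+ 2) ->
  forall n, (n0 <= n)%N -> sigma n <= C * M * phi n.
Proof.
move=> n00 M0 C0 phi0 sM rec init step; elim/ltn_ind => n IH le_n0n.
have [lt_n|le_n] := ltnP n (4 * n0).
  have /andP[_ le_sM] := sM n; apply: le_trans le_sM _.
  by rewrite mulrAC ler_peMl// init// le_n0n.
have [m [N [le_m nE le_N lt_m]]] : exists m N, [/\ (n0 <= m)%N,
    (n = N + (m + m))%N, (n <= N.*2)%N & (n < 4 * m.+1)%N].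
  (* As [n >= 4 * n0], the quarter [m] is at least [n0], and [N] lies between [n / 2] and
     [n - 2]. *)
  by exists (n %/ 4)%N, (n - (n %/ 4 + n %/ 4))%N; split; lia.
have sN : sigma N <= C * M * phi N by apply: IH; lia.
have s0 k : 0 <= sigma k by have /andP[] := sM k.
rewrite -(ler_pXn2r (ltn0Sn 1)) ?nnegrE ?mulr_ge0// [in leLHS]nE.
apply: le_trans (rec _ _ le_m) _.
(* The induction hypothesis brings in one factor [C] while the target has [C ^+ 2]; the spare factor
   absorbs the comparison of rates, so the constant does not grow. *)
apply: (@le_trans _ _ (8 * (C * M * phi N) * (M * phi m))).
  by rewrite ler_wpM2r ?mulr_ge0// ler_wpM2l.
have -> : 8 * (C * M * phi N) * (M * phi m) =
    C * M ^+ 2 * (8 * (phi N * phi m)) by ring.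
have -> : (C * M * phi n) ^+ 2 = C * M ^+ 2 * (C * phi n ^+ 2) by ring.
by rewrite ler_wpM2l ?mulr_ge0 ?exprn_ge0// step.
Qed.

Lemma linear_sampling_width_rate (R : realType) (D : Type) (K : D -> D -> R[i])
    (H : rkhs K) (phi : nat -> R) (C C0 : R) n0 :
    [set: D] !=set0 -> (kernel_radius K < +oo)%E ->
    (0 < n0)%N -> 0 < C0 -> 0 <= C -> (forall n, 0 <= phi n) ->
    (forall n, (n0 <= n < 4 * n0)%N -> 1 <= C * phi n) ->
    (forall n N m, (n0 <= m)%N -> (n = N + (m + m))%N -> (n <= N.*2)%N ->
       (n < 4 * m.+1)%N -> 8 * (phi N * phi m) <= C * phi n ^+ 2) ->
    (forall n, (n0 <= n)%N -> (gelfand_width H n <= (C0 * phi n)%:E)%E) ->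
  forall n, (n0 <= n)%N ->
    (linear_sampling_width H n <=
       C%:E * maxe C0%:E (kernel_radius K) * (phi n)%:E)%E.
Proof.
move=> D0 Kfin n00 C0_gt0 C_ge0 phi0 init step gelf n le_n.
have [r [-> r0 kr]] := kernel_radiusP H D0 Kfin.
have [sigma [sr lin rec]] := greedy_rate D0 r0 kr.
rewrite -EFin_max -!EFinM; set M := Num.max C0 r.
have CM : C0 <= M by rewrite le_max lexx.
have M0 : 0 < M by rewrite lt_max C0_gt0.
apply: le_trans (lin n) _; rewrite lee_fin.
apply: (rate_of_recursion (n0 := n0)) => //; first exact: ltW.
  move=> j; have /andP[-> sn] := sr j.
  by rewrite le_max sn orbT.
move=> {le_n}{}n m le_m.
(* The infimum defining the width need not be attained, so the recursion is used for all
   [e > M * phi m] and [e] is then let decrease. *)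
have rec' e : M * phi m < e -> sigma (n + (m + m))%N ^+ 2 <= 8 * sigma n * e.
  move=> lt_e; apply: rec; first exact: leq_trans le_m.
    by apply: le_lt_trans lt_e; rewrite mulr_ge0// ltW.
  apply: le_lt_trans (gelf _ le_m) _; rewrite lte_fin (le_lt_trans _ lt_e)//.
  by rewrite ler_wpM2r.
have [s0|s_neq0] := eqVneq (sigma n) 0.
  have lt1 : M * phi m < M * phi m + 1 by rewrite ltrDl.
  by have := rec' _ lt1; rewrite s0 mulr0 !mul0r.
have s_gt0 : 0 < 8 * sigma n.
  by rewrite mulr_gt0// lt_def s_neq0; have /andP[] := sr n.
rewrite mulrC -ler_pdivrMr//; apply/unstable.ler_gtP => e lt_e.
by rewrite ler_pdivrMr// mulrC rec'.
Qed.

(** The absolute value covers both signs: for [b >= 0] raise [y <= c * x] to the power [b]; for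
    [b < 0] the power is increasing and [c >= 1]. *)
Lemma powRN_doubling (R : realType) (x y c b : R) :
    0 < x -> x <= y -> y <= c * x ->
  x `^ (- b) <= c `^ `|b| * y `^ (- b).
Proof.
move=> x0 xy ycx; have y0 : 0 < y by apply: lt_le_trans xy.
have c1 : 1 <= c by rewrite -(ler_pM2r x0) mul1r (le_trans xy).
have c0 : 0 <= c by apply: le_trans c1.
have [b0|b0] := leP 0 b.
  rewrite ger0_norm// !powRN ler_pdivlMr ?powR_gt0// mulrC.
  rewrite ler_pdivrMr ?powR_gt0// -powRM ?(ltW x0)//.
  by rewrite ge0_ler_powR// nnegrE ?mulr_ge0// ltW.
apply: (@le_trans _ _ (y `^ (- b))).
  by apply: ge0_ler_powR; rewrite ?nnegrE ?oppr_ge0 // ltW.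
by rewrite ler_peMl ?powR_ge0// -[leLHS](powRr0 c) ler_powR.
Qed.

Definition log_rate (R : realType) (alpha beta : R) (n : nat) : R :=
  n%:R `^ (- alpha) * (ln n%:R) `^ (- beta).

Lemma ln_nat_gt0 (R : realType) n : (2 <= n)%N -> 0 < ln n%:R :> R.
Proof. by move=> n2; rewrite ln_gt0// ltr1n. Qed.

Lemma log_rate_doubling (R : realType) (alpha beta : R) m n :
    (2 <= m)%N -> (m <= n)%N -> (n <= 8 * m)%N ->
  log_rate alpha beta m <=
    (8 `^ `|alpha| * 4 `^ `|beta|) * log_rate alpha beta n.
Proof.
move=> m2 mn nm; rewrite /log_rate mulrACA ler_pM ?powR_ge0//.
  apply: powRN_doubling; rewrite ?ltr0n ?ler_nat ?(leq_trans _ m2)//.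
  by rewrite -natrM ler_nat.
have m0 : 0 < m%:R :> R by rewrite ltr0n; lia.
have n0 : 0 < n%:R :> R by rewrite ltr0n; lia.
apply: powRN_doubling; rewrite ?ln_nat_gt0//; first by rewrite ler_ln ?ler_nat.
(* Since [8 <= m ^ 3] for [m >= 2], [n <= m ^ 4] and [ln n <= 4 * ln m]. *)
rewrite mulr_natl -lnXn// ler_ln ?posrE ?exprn_gt0// -natrX ler_nat.
rewrite (leq_trans nm)// mulnC (expnS m 3) leq_mul2l.
by rewrite (leq_exp2r 2 m (ltn0Sn 2)) m2 orbT.
Qed.

Theorem corollary2p3 (R : realType) :
  (forall (D : Type) (K : D -> D -> R[i]) (H : rkhs K),
     [set: D] !=set0 -> (kernel_radius K < +oo)%E ->
     forall alpha C0 : R, 0 < alpha -> 0 < C0 ->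
     (forall n : nat, (1 <= n)%N ->
        (gelfand_width H n <= (C0 * (1 + n%:R) `^ (- alpha))%:E)%E) ->
     forall n : nat, (1 <= n)%N ->
       (linear_sampling_width H n <=
          (2 `^ (5 * alpha + 3))%:E * maxe C0%:E (kernel_radius K)
          * ((1 + n%:R) `^ (- alpha))%:E)%E)
  /\
  (forall alpha beta : R,
     0 < alpha \/ (alpha = 0 /\ 0 < beta) ->
     exists C : R,
     forall (D : Type) (K : D -> D -> R[i]) (H : rkhs K),
     [set: D] !=set0 -> (kernel_radius K < +oo)%E ->
     forall C0 : R, 0 < C0 ->
     (forall n : nat, (2 <= n)%N ->
        (gelfand_width H n <=
           (C0 * n%:R `^ (- alpha) * (ln n%:R) `^ (- beta))%:E)%E) ->
     forall n : nat, (2 <= n)%N ->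
       (linear_sampling_width H n <=
          C%:E * maxe C0%:E (kernel_radius K)
          * (n%:R `^ (- alpha) * (ln n%:R) `^ (- beta))%:E)%E).
Proof.
split=> [D K H D0 Kfin alpha C0 alpha0 C0_gt0 gelf|alpha beta _].
  pose phi n : R := (1 + n%:R) `^ (- alpha).
  have phi_le c m n : (m <= n)%N -> (n.+1 <= c * m.+1)%N ->
      phi m <= c%:R `^ alpha * phi n.
    move=> mn nm; rewrite -[alpha in leRHS]gtr0_norm// /phi !nat1r.
    apply: powRN_doubling; rewrite ?ltr0n ?ler_nat//.
    (* The shift by one in [phi] turns the comparison of indices into one of successors, so that
       [m = 0] is allowed. *)
    by rewrite -natrM ler_nat.
  have pow2 c : (2 ^+ c) `^ alpha = 2 `^ (c%:R * alpha) :> R.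
    by rewrite -powR_mulrn// -powRrM.
  have C2 c : c <= 5 * alpha + 3 -> 2 `^ c <= 2 `^ (5 * alpha + 3) :> R.
    by move=> h; rewrite ler_powR// ler1n.
  apply: (linear_sampling_width_rate (phi := phi)) => //.
  - by move=> n; exact: powR_ge0.
  - move=> n /andP[n1 n4].
    have phi_0 : 1 = phi 0 by rewrite /phi addr0 powR1.
    rewrite [leLHS]phi_0 (le_trans (phi_le 4 _ n _ _))//.
    rewrite ler_wpM2r ?powR_ge0//.
    have -> : 4 = 2 ^+ 2 :> R by rewrite -natrX.
    by rewrite pow2; apply: C2; lra.
  - move=> n N m m1 nE nN nm.
    have h1 : phi N <= 2 `^ alpha * phi n by apply: (phi_le 2); lia.
    have h2 : phi m <= 4 `^ alpha * phi n by apply: (phi_le 4); lia.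
    (* The constant needed here is [8 * 2 ^ alpha * 4 ^ alpha = 2 ^ (3 alpha + 3)]; the initial
       range needed [4 ^ alpha]. *)
    apply: (@le_trans _ _ (8 * ((2 `^ alpha * phi n) * (4 `^ alpha * phi n)))).
      by rewrite ler_wpM2l// ler_pM ?powR_ge0.
    rewrite mulrACA -expr2 mulrA ler_wpM2r ?exprn_ge0 ?powR_ge0//.
    have -> : 4 = 2 ^+ 2 :> R by rewrite -natrX.
    have -> : 8 = 2 `^ 3 :> R by rewrite powR_mulrn// -natrX.
    rewrite pow2 -!powRD ?pnatr_eq0 ?implybT//.
    by apply: C2; lra.
pose phi := log_rate alpha beta.
pose c : R := 8 `^ `|alpha| * 4 `^ `|beta|.
have c0 : 0 < c by rewrite mulr_gt0 ?powR_gt0.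
have phi0 n : 0 <= phi n by rewrite mulr_ge0 ?powR_ge0.
have phi2 : 0 < phi 2%N by rewrite mulr_gt0 ?powR_gt0 ?ln_nat_gt0.
have phi_le m n : (2 <= m)%N -> (m <= n)%N -> (n <= 8 * m)%N ->
  phi m <= c * phi n by exact: log_rate_doubling.
(* The first term serves the recursion, the second the initial range [2 <= n < 8], where [phi n] is
   compared with [phi 2]. *)
exists (8 * c ^+ 2 + c / phi 2%N) => D K H D0 Kfin C0 C0_gt0 gelf.
have a0 : 0 <= 8 * c ^+ 2 by rewrite mulr_ge0 ?exprn_ge0 ?ltW.
have b0 : 0 <= c / phi 2%N by rewrite divr_ge0 ?ltW.
apply: (linear_sampling_width_rate (phi := phi)) => //.
- exact: addr_ge0.
- move=> n /andP[n2 n8]; have h : phi 2%N <= c * phi n by apply: phi_le; lia.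
  rewrite mulrDl ler_wpDl ?(mulr_ge0 a0)//.
  by rewrite mulrAC ler_pdivlMr// mul1r.
- move=> n N m m1 nE nN nm.
  have h1 : phi N <= c * phi n by apply: phi_le; lia.
  have h2 : phi m <= c * phi n by apply: phi_le; lia.
  apply: (@le_trans _ _ (8 * c ^+ 2 * phi n ^+ 2)).
    by rewrite -mulrA -exprMn expr2 ler_wpM2l// ler_pM.
  by rewrite ler_wpM2r ?exprn_ge0// lerDl.
- by move=> n n2; rewrite mulrA; exact: gelf.
Qed.
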